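(* Define the sequence $s_{18}(n)$ by $s_{18}(0)=1$ and, for $n \geq 1$, \[ s_{18}(n) = \sum_{k=0}^{\lfloor n/3 \rfloor} (-1)^k \binom{n}{k}\binom{2k}{k}\binom{2(n-k)}{n-k}\left[\binom{2n-3k-1}{n} + \binom{2n-3k}{n}\right]. \] Then for all integers $m \geq 1$, $r \geq 1$ and all primes $p$, \[ s_{18}(m p^r) \equiv s_{18}(m p^{r-1}) \pmod{p^{2r}}. \]
   Context: $\lfloor x\rfloor$ denotes the largest integer not exceeding $x$. Binomial coefficients $\binom{a}{b}$ with integers $0 \le a < b$ are $0$. *)

(* Defs.v *)
From mathcomp Require Import all_boot all_order all_algebra.

Set Implicit Arguments.
Unset Strict Implicit.
Unset Printing Implicit Defensive.

Import GRing.Theory.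
Local Open Scope ring_scope.

(* The natural-number subtractions are never truncated here: k <= n %/ 3 and
   1 <= n give k <= n and 2 * n - 3 * k - 1 >= n - 1 >= 0. *)
Definition s18 (n : nat) : int :=
  if n == 0%N then 1
  else \sum_(0 <= k < (n %/ 3).+1)
         (-1) ^+ k
         * ('C(n, k))%:Z * ('C(2 * k, k))%:Z * ('C(2 * (n - k), n - k))%:Z
         * (('C(2 * n - 3 * k - 1, n))%:Z + ('C(2 * n - 3 * k, n))%:Z).

(* Main.v *)
(* Write n = p N with p^e | N.  The product A_n(k) = C(n,k) C(2k,k) C(2(n-k),n-k)
   is C(n,k)^2 times the super Catalan number (2k)! (2n-2k)! / (k! (n-k)! n!), an
   even integer.  If p does not divide k then p^(e+1) | C(n,k), so the k-th term of
   s18(n) vanishes modulo p^(2e+2).  For k = p j, put p^w = gcd(j, p^e): the j-th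
   term of s18(N) is divisible by p^(2(e-w)), and by one more factor 2 if p = 2.
   The terms of index p j in s18(n) and j in s18(N) differ by a factor built from
   u(a) = (p a)! / (p^a a!), and u(a+b) = u(a) u(b) modulo p^(2w+2) (modulo 2^(2w+1)
   if p = 2) whenever p^w | a, b, so this factor is 1 up to the missing power of p. *)
Require Import Defs.
From mathcomp Require Import all_boot all_order all_algebra.
From mathcomp Require Import zify ring.

Set Implicit Arguments.
Unset Strict Implicit.
Unset Printing Implicit Defensive.

(** * Super Catalan numbers *)

(** The quotient [c] is S(a, b) = (2a)! (2b)! / (a! b! (a+b)!). The recurrence used in the induction
    on [b] subtracts, so [c] is an integer; both of its terms are even. *)
Lemma central_bin_prod_dvd (a b : nat) :
  exists2 c : int, Posz ('C(2 * a, a) * 'C(2 * b, b)) = (Posz 'C(a + b, a) * c)%R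
    & (0 < a + b)%N -> (2 %| c)%Z.
Proof.
elim: b a => [|b IHb] a.
  exists (Posz 'C(2 * a, a)); first by rewrite addn0 !binn muln1 GRing.mul1r.
  case: a => // a _; rewrite mulnS.
  have E : 'C((2 * a).+2, a.+1) = 2 * 'C((2 * a).+1, a).
    apply/eqP; rewrite -(eqn_pmul2l (ltn0Sn a)) -mul_bin_diag mulnA /=.
    by apply/eqP; congr muln; lia.
  by rewrite [(2 + _)%N]add2n E PoszM dvdz_mulr.
have [c Ec Dc] := IHb a; have [c' Ec' Dc'] := IHb a.+1.
(* Super Catalan recurrence: [S(a, b+1) = 4 S(a, b) - S(a+1, b)]. *)
exists (4 * c - c')%R; last first.
  by move=> _; have := Dc' isT; lia.
have central x : (x.+1 * 'C(2 * x.+1, x.+1) = 2 * (2 * x + 1) * 'C(2 * x, x))%N.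
  have := mul_bin_down (2 * x).+1 x; have := mul_bin_diag (2 * x).+2 x.
  by rewrite (_ : (2 * x).+1 - x = x.+1)%N; [rewrite mulnS add2n /=; lia | lia].
have B1 : (b.+1 * 'C(a + b.+1, a) = (a + b).+1 * 'C(a + b, a))%N.
  have := mul_bin_down (a + b).+1 a.
  by rewrite addnS (_ : (a + b).+1 - a = b.+1)%N; [move=> <- | lia].
have B2 : (a.+1 * 'C(a.+1 + b, a.+1) = (a + b).+1 * 'C(a + b, a))%N.
  by rewrite mulSn addSn mul_bin_diag.
have U_neq0 : (Posz 'C(a + b, a) != 0)%R.
  by have := bin_gt0 (a + b) a; rewrite leq_addr; lia.
have Ca := central a; have Cb := central b.
move: Ec Ec' B1 B2 Ca Cb U_neq0; rewrite !PoszM.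
move: 'C(a + b, a) 'C(a + b.+1, a) 'C(a.+1 + b, a.+1) => U V W.
move: 'C(2 * a, a) 'C(2 * a.+1, a.+1) 'C(2 * b, b) 'C(2 * b.+1, b.+1) => P P' Q Q'.
move=> H0 H1 H3 H4 H6 H5 U_neq0.
(* The ratio S(a+1, b) / S(a, b). By symmetry S(a, b+1) / S(a, b) has numerator 2(2b+1) over the
   same a+b+1, and the recurrence is 2(2a+1) + 2(2b+1) = 4(a+b+1). *)
have E1 : (Posz (a + b).+1 * c' = 2 * (2 * Posz a + 1) * c)%R.
  apply: (GRing.mulfI U_neq0).
  have K0 := congr1 (fun t => 2 * (2 * Posz a + 1) * t)%R H0.
  have K1 := congr1 (fun t => Posz a.+1 * t)%R H1.
  have K4 := congr1 (fun t => Posz t * c')%R H4.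
  have K6 := congr1 (fun t => Posz t * Posz Q)%R H6.
  lia.
have b_neq0 : (Posz b.+1 != 0)%R by [].
apply: (GRing.mulfI b_neq0).
have K0 := congr1 (fun t => 2 * (2 * Posz b + 1) * t)%R H0.
have K1 := congr1 (fun t => Posz U * t)%R E1.
have K3 := congr1 (fun t => Posz t * (4 * c - c'))%R H3.
have K5 := congr1 (fun t => Posz t * Posz P)%R H5.
lia.
Qed.

(** * Factorials without their multiples of p *)

Section Factorials.

Variable p : nat.
Hypothesis p_pr : prime p.

(** Kept general to serve both the product (pa)! and the sum over k. *)
Lemma big_dvdn_nat (R : Type) (idx : R) (op : Monoid.com_law idx)
    (F : nat -> R) (n : nat) :
  \big[op/idx]_(1 <= i < n.+1 | p %| i) F i
    = \big[op/idx]_(1 <= j < (n %/ p).+1) F (p * j)%N.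
Proof.
elim: n => [|n IHn]; first by rewrite div0n !big_geq.
rewrite big_mkcond big_nat_recr //= -big_mkcond IHn divnS ?prime_gt0 //.
case: ifP => [dvd_p|_]; last by rewrite Monoid.mulm1.
rewrite add1n [RHS]big_nat_recr //=; congr (op _ (F _)).
move: dvd_p => /dvdnP[q Eq]; have := divnS n (prime_gt0 p_pr).
by rewrite Eq dvdn_mull // mulnK ?prime_gt0 // => ->; rewrite add1n mulnC.
Qed.

(** Up to sign, the value at pa of Morita's p-adic Gamma function. *)
Definition ufact (a : nat) : nat := \prod_(1 <= i < p * a | ~~ (p %| i)) i.

Lemma fact_mul_ufact (a : nat) : ((p * a)`! = p ^ a * a`! * ufact a)%N.
Proof.
rewrite fact_prod (bigID (fun i => p %| i)) /= big_dvdn_nat mulKn ?prime_gt0 //.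
rewrite big_split /= prod_nat_const_nat subSS subn0 -fact_prod; congr (_ * _)%N.
rewrite /ufact; case: (posnP (p * a)) => [->|pa_gt0]; first by rewrite !big_geq.
rewrite big_mkcond big_nat_recr //= dvdn_mulr //= muln1 -big_mkcond //.
Qed.

Lemma ufactD (a b : nat) :
  ufact (a + b) = (ufact b * \prod_(1 <= i < p * a | ~~ (p %| i)) (p * b + i))%N.
Proof.
rewrite /ufact.
case: (posnP a) => [->|a_gt0].
  by rewrite add0n muln0 [X in (\prod_(_ <= _ < _ | _) _ * X)%N]big_geq // muln1.
case: (posnP b) => [->|b_gt0].
  by rewrite addn0 muln0 [X in (X * \prod_(_ <= _ < _ | _) _)%N]big_geq // mul1n.
have p_gt0 := prime_gt0 p_pr.
rewrite (@big_cat_nat _ _ _ (p * b)) /=; [|nia|nia].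
congr (_ * _)%N.
(* The upper block starts at pb, a multiple of p, so that index drops out before the shift by pb. *)
rewrite big_mkcond big_ltn /=; last by nia.
rewrite dvdn_mulr //= mul1n -big_mkcond /= -{1}[(p * b).+1]add1n.
rewrite big_addn (_ : (p * (a + b) - p * b = p * a)%N); last by rewrite mulnDr addnK.
apply: eq_big => [i|i _]; last exact: addnC.
by rewrite dvdn_addl // dvdn_mulr.
Qed.

Lemma ufact_coprime (a e : nat) : coprime (p ^ e) (ufact a).
Proof.
apply: coprimeXl; rewrite /ufact.
elim/big_ind: _ => [|x y|i]; first exact: coprimen1.
  by rewrite coprimeMr => -> ->.
by rewrite prime_coprime.
Qed.

Lemma ufact_shift_modn (a b w : nat) : p ^ w %| b ->
  \prod_(1 <= i < p * a | ~~ (p %| i)) (p * b + i) = ufact a %[mod p ^ w.+1].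
Proof.
move=> /dvdnP[c ->]; rewrite /ufact.
elim/big_ind2: _ => // [x1 x2 y1 y2 E1 E2|i _].
  by rewrite -modnMm E1 E2 modnMm.
by rewrite mulnCA -expnS modnMDl.
Qed.

Lemma prod_rev_ndvd (F : nat -> nat) (a : nat) :
  \prod_(1 <= i < p * a | ~~ (p %| i)) F i
    = \prod_(1 <= i < p * a | ~~ (p %| i)) F (p * a - i)%N.
Proof.
rewrite big_mkcond big_nat_rev /= [RHS]big_mkcond /=.
apply: eq_big_nat => i /andP[i_gt0 lt_i]; rewrite add1n subSS.
by rewrite dvdn_subr ?dvdn_mulr // ltnW.
Qed.

(* Pairing [i] with [p a - i] makes the terms linear in [p b] cancel. *)
Lemma ufact_shift_sqr_modn (a b w : nat) : p ^ w %| a -> p ^ w %| b ->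
  (\prod_(1 <= i < p * a | ~~ (p %| i)) (p * b + i)) ^ 2 = ufact a ^ 2
    %[mod p ^ w.*2.+2].
Proof.
move=> dvd_a dvd_b; rewrite -!mulnn.
rewrite [in X in (_ * X)%N %% _](prod_rev_ndvd (fun i => p * b + i)%N).
rewrite [in X in _ = (_ * X)%N %[mod _]]/ufact (prod_rev_ndvd id) /ufact.
rewrite -[in X in X %% _]big_split -big_split /=.
rewrite [in X in X %% _]big_nat_cond [in RHS]big_nat_cond.
elim/big_ind2: _ => // [x1 x2 y1 y2 E1 E2|i /andP[/andP[_ lt_i] _]].
  by rewrite -modnMm E1 E2 modnMm.
(* The shift changes each pair by p^2 b(a+b), a multiple of p^(2w+2). *)
have -> : ((p * b + i) * (p * b + (p * a - i))
    = (p * p) * (b * (a + b)) + i * (p * a - i))%N by nia.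
have /dvdnP[q ->] : p ^ w.*2.+2 %| (p * p) * (b * (a + b)).
  rewrite !expnS -addnn expnD mulnA !dvdn_mul //.
  by rewrite dvdn_add.
by rewrite modnMDl.
Qed.

(** With X the shifted product and Y = u(a), p^(2w+2) divides (X-Y)(X+Y), and X+Y = (X-Y) + 2Y is
    prime to p for odd p. For p = 2 it is even, which costs one factor 2. *)
Lemma ufactD_modn (a b w : nat) : p ^ w %| a -> p ^ w %| b ->
  ufact (a + b) = ufact a * ufact b %[mod p ^ (w.*2.+2 - (p == 2))].
Proof.
move=> dvd_a dvd_b; rewrite ufactD mulnC.
set X := bigop _ _ _; set Y := ufact a.
suff XY : X = Y %[mod p ^ (w.*2.+2 - (p == 2))] by rewrite -modnMml XY modnMml.
have leYX : Y <= X by apply: leq_prod => i _; apply: leq_addl.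
have dXY : p ^ w.+1 %| X - Y.
  by rewrite -eqn_mod_dvd //; apply/eqP; apply: ufact_shift_modn.
have dX2Y2 : p ^ w.*2.+2 %| (X - Y) * (X + Y).
  rewrite -subn_sqr -eqn_mod_dvd ?leq_sqr //; apply/eqP.
  exact: ufact_shift_sqr_modn.
have EXY : X + Y = X - Y + 2 * Y by rewrite mul2n -addnn addnA subnK.
apply/eqP; rewrite eqn_mod_dvd //.
have pY : ~~ (p %| Y) by rewrite -prime_coprime // -(expn1 p) ufact_coprime.
have [p2|p_odd] := eqVneq p 2; last first.
  move: dX2Y2; rewrite subn0 Gauss_dvdl // coprimeXl //.
  rewrite prime_coprime // EXY dvdn_addr; last first.
    by apply: dvdn_trans dXY; rewrite dvdn_exp.
  by rewrite Euclid_dvdM // negb_or pY andbT dvdn_prime2.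
(* For p = 2 and w = 0 the modulus is only 2, and [dXY] suffices. For larger w, 4 divides X-Y, so
   (X+Y)/2 is odd. *)
case: w dvd_a dvd_b dXY dX2Y2 => [|w] _ _ dXY dX2Y2; first by [].
have d4 : 4 %| X - Y.
  by apply: dvdn_trans dXY; rewrite p2 -[4]/(2 ^ 2) dvdn_exp2l.
have EXY2 : X + Y = 2 * ((X - Y) %/ 4 * 2 + Y).
  by rewrite EXY mulnDr mulnCA -[2 * 2]/4 divnK.
move: dX2Y2; rewrite EXY2 mulnCA p2 (expnS 2 _.+1) dvdn_pmul2l // subn1 /=.
rewrite Gauss_dvdl // coprimeXl // prime_coprime // dvdn_addr ?dvdn_mull //.
by rewrite -p2.
Qed.

(** * Scaling the arguments of binomials by p *)

Lemma bin_mul_ufact (a b : nat) : b <= a ->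
  'C(p * a, p * b) * (ufact b * ufact (a - b)) = 'C(a, b) * ufact a.
Proof.
move=> le_ba; have p_gt0 := prime_gt0 p_pr.
have E1 := bin_fact le_ba.
have E2 : 'C(p * a, p * b) * ((p * b)`! * (p * (a - b))`!) = (p * a)`!.
  by rewrite mulnBr bin_fact // leq_mul2l le_ba orbT.
apply/eqP.
have : 0 < p ^ a * (b`! * (a - b)`!) by rewrite !muln_gt0 expn_gt0 p_gt0 !fact_gt0.
move=> /eqn_pmul2l <-.
move: E2; rewrite !fact_mul_ufact -E1.
have -> : p ^ a = p ^ b * p ^ (a - b) by rewrite -expnD subnKC.
move=> E; apply/eqP; lia.
Qed.

(** The ratio (a-b)/a of C(a-1, b) to C(a, b) is unchanged when a and b are scaled by p, so both
    binomials of [s18_tail] acquire the same factor. *)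
Lemma bin_pred_mul_ufact (a b : nat) : 0 < a -> b <= a ->
  'C((p * a).-1, p * b) * (ufact b * ufact (a - b)) = 'C(a.-1, b) * ufact a.
Proof.
move=> a_gt0 le_ba; have p_gt0 := prime_gt0 p_pr.
have E := bin_mul_ufact le_ba.
have E1 := mul_bin_down a b; have E2 := mul_bin_down (p * a) (p * b).
have pa_gt0 : 0 < p * a by rewrite muln_gt0 p_gt0.
apply/eqP; rewrite -(eqn_pmul2l pa_gt0); apply/eqP.
rewrite mulnA E2 -mulnBr -mulnA E -[RHS]mulnA [X in _ = p * X]mulnA E1.
by rewrite !mulnA.
Qed.

(** This factor of the summand supplies all the divisibility; of [s18_tail] only the scaling by p
    matters. *)
Definition s18_base (n k : nat) : nat :=
  'C(n, k) * 'C(2 * k, k) * 'C(2 * (n - k), n - k).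

Definition s18_tail (n k : nat) : nat :=
  'C(2 * n - 3 * k - 1, n) + 'C(2 * n - 3 * k, n).

Lemma s18_base_mul_ufact (n k : nat) : k <= n ->
  s18_base (p * n) (p * k) * (ufact k ^ 3 * ufact (n - k) ^ 3)
    = s18_base n k * (ufact n * ufact (2 * k) * ufact (2 * (n - k))).
Proof.
move=> le_kn; rewrite /s18_base.
have E1 := bin_mul_ufact le_kn.
have E2 : k <= 2 * k by lia.
have {}E2 := bin_mul_ufact E2.
have E3 : n - k <= 2 * (n - k) by lia.
have {}E3 := bin_mul_ufact E3.
rewrite -mulnBr.
move: E2 E3; rewrite !(mulnCA p 2) (_ : 2 * k - k = k); last by lia.
rewrite (_ : 2 * (n - k) - (n - k) = n - k); last by lia.
move=> E2 E3.
transitivity ('C(p * n, p * k) * (ufact k * ufact (n - k))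
  * ('C(2 * (p * k), p * k) * (ufact k * ufact k))
  * ('C(2 * (p * (n - k)), p * (n - k)) * (ufact (n - k) * ufact (n - k)))).
  by ring.
by rewrite E1 E2 E3; ring.
Qed.

Lemma s18_tail_mul_ufact (n k : nat) : 0 < n -> 3 * k <= n ->
  s18_tail (p * n) (p * k) * (ufact n * ufact (n - 3 * k))
    = s18_tail n k * ufact (2 * n - 3 * k).
Proof.
move=> n_gt0 le_kn; rewrite /s18_tail.
have -> : 2 * (p * n) - 3 * (p * k) = p * (2 * n - 3 * k).
  by rewrite mulnBr !(mulnCA p).
have -> : n - 3 * k = 2 * n - 3 * k - n by lia.
rewrite !subn1 mulnDl bin_mul_ufact ?bin_pred_mul_ufact ?mulnDl //; lia.
Qed.

(** These are the numerator and denominator of the scaling factor of a whole term, u(n) cancelled.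
    By multiplicativity of u, the numerator reduces to the denominator, using 2n-3k = k + (n-k) +
    (n-3k). *)
Lemma ufact_ratio_modn (n k w : nat) : 3 * k <= n -> p ^ w %| n -> p ^ w %| k ->
  ufact (2 * k) * ufact (2 * (n - k)) * ufact (2 * n - 3 * k)
    = ufact k ^ 3 * ufact (n - k) ^ 3 * ufact (n - 3 * k)
    %[mod p ^ (w.*2.+2 - (p == 2))].
Proof.
move=> le_kn dn dk.
have E2n : 2 * n - 3 * k = n + (n - 3 * k) by lia.
have le_kn' : k <= n by lia.
have dnk : p ^ w %| n - k by rewrite dvdn_sub.
have dn3k : p ^ w %| n - 3 * k by rewrite dvdn_sub // dvdn_mull.
set d := p ^ _.
have modM x x' y y' : x = x' %[mod d] -> y = y' %[mod d] -> x * y = x' * y' %[mod d].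
  by move=> Ex Ey; rewrite -modnMm Ex Ey modnMm.
have double x : p ^ w %| x -> ufact (2 * x) = ufact x * ufact x %[mod d].
  by move=> dx; rewrite mul2n -addnn; apply: ufactD_modn.
have En : ufact n = ufact k * ufact (n - k) %[mod d].
  by have := ufactD_modn dk dnk; rewrite subnKC.
have E3 : ufact (2 * n - 3 * k) = ufact k * ufact (n - k) * ufact (n - 3 * k) %[mod d].
  by rewrite E2n (ufactD_modn dn dn3k); apply: modM.
rewrite (modM _ _ _ _ (modM _ _ _ _ (double _ dk) (double _ dnk)) E3).
by congr (_ %% _); ring.
Qed.

(** * Divisibility of the terms *)

Lemma s18_base_dvd (n k e : nat) : 0 < n -> k <= n -> p ^ e %| n ->
  exists2 w, w <= e /\ p ^ w %| k & p ^ ((e - w).*2 + (p == 2)) %| s18_base n k.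
Proof.
move=> n_gt0 le_kn dn.
have [w le_we Ew] : exists2 w, w <= e & gcdn k (p ^ e) = p ^ w.
  by apply/(dvdn_pfactor _ _ p_pr); apply: dvdn_gcdr.
exists w; first by rewrite -Ew dvdn_gcdl.
(* p^w C(n, k) is the gcd of k C(n, k) = n C(n-1, k-1) and p^e C(n, k), both multiples of p^e. *)
have dC : p ^ (e - w) %| 'C(n, k).
  have pw_gt0 : 0 < p ^ w by rewrite expn_gt0 prime_gt0.
  rewrite -(dvdn_pmul2l pw_gt0) -expnD subnKC // -Ew muln_gcdl dvdn_gcd.
  rewrite (dvdn_mulr _ (dvdnn (p ^ e))) andbT.
  case: k le_kn {Ew} => [|k] // _.
  by rewrite -mul_bin_diag dvdn_mulr.
have [c Ec c_even] := central_bin_prod_dvd k (n - k).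
rewrite subnKC // in Ec c_even.
rewrite -[_ %| _]/(Posz (p ^ _) %| Posz _)%Z /s18_base -mulnA PoszM Ec GRing.mulrA.
rewrite expnD -addnn expnD !PoszM !dvdz_mul // ?dvdzE //.
by case: eqP => // ->; rewrite expn1 -dvdzE c_even.
Qed.

Lemma s18_base_dvd_ndvd (n k e : nat) :
  0 < n -> k <= n -> p ^ e %| n -> ~~ (p %| k) -> p ^ (2 * e) %| s18_base n k.
Proof.
move=> n_gt0 le_kn dn pk; have [w [_ dk] d] := s18_base_dvd n_gt0 le_kn dn.
apply: dvdn_trans d; apply: dvdn_exp2l.
case: w dk => [_|w dk]; first by rewrite subn0 -mul2n leq_addr.
by case/negP: pk; apply: dvdn_trans dk; rewrite expnS dvdn_mulr.
Qed.

(** * Comparison of terms and summation *)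

Local Open Scope ring_scope.

Definition s18_term (n k : nat) : int :=
  (-1) ^+ k * Posz (s18_base n k * s18_tail n k).

Lemma s18_termMp_modz (n k e : nat) :
  (0 < n)%N -> (3 * k <= n)%N -> (p ^ e %| n)%N ->
  (Posz (p ^ (2 * e.+1)) %| s18_term (p * n) (p * k) - s18_term n k)%Z.
Proof.
move=> n_gt0 le_kn dn; have le_kn' : (k <= n)%N by lia.
have [w [le_we dk] dbase] := s18_base_dvd n_gt0 le_kn' dn.
have dn' : (p ^ w %| n)%N by apply: dvdn_trans dn; apply: dvdn_exp2l.
have := ufact_ratio_modn le_kn dn' dk.
have Eb := s18_base_mul_ufact le_kn'; have Et := s18_tail_mul_ufact n_gt0 le_kn.
set D := (_ * ufact (n - 3 * k))%N; set E := (_ * _)%N => ED.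
set T' := (s18_base (p * n) (p * k) * s18_tail (p * n) (p * k))%N.
set T := (s18_base n k * s18_tail n k)%N.
have fn_gt0 : (0 < ufact n)%N.
  have := ufact_coprime n 1; case: (posnP (ufact n)) => // ->.
  by rewrite expn1 /coprime gcdn0; case/eqP=> p1; move: p_pr; rewrite p1.
have ET : (T' * D = T * E)%N.
  apply/eqP; rewrite -(eqn_pmul2r fn_gt0); apply/eqP.
  transitivity ((s18_base (p * n) (p * k) * (ufact k ^ 3 * ufact (n - k) ^ 3))
    * (s18_tail (p * n) (p * k) * (ufact n * ufact (n - 3 * k))))%N.
    by rewrite /T' /D; ring.
  by rewrite Eb Et /T /E; ring.
have coD : coprimez (Posz (p ^ (2 * e.+1))) (Posz D).
  by rewrite coprimezE !coprimeMr !ufact_coprime.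
(* Multiplying by [D], prime to p, turns the difference of terms into [T] times a signed difference
   of [E] and [D]. *)
rewrite -(Gauss_dvdzr _ coD) /s18_term -/T -/T'.
have -> : Posz D * ((-1) ^+ (p * k) * Posz T' - (-1) ^+ k * Posz T)
    = Posz T * ((-1) ^+ (p * k) * Posz E - (-1) ^+ k * Posz D).
  have ETz : Posz T' * Posz D = Posz T * Posz E by rewrite -!PoszM ET.
  by rewrite !GRing.mulrBr GRing.mulrCA (GRing.mulrC (Posz D)) ETz; ring.
(* The first summand is the exponent from [T], the second that from [E] - [D]; the corrections for p
   = 2 cancel. *)
have -> : (2 * e.+1 = (e - w).*2 + (p == 2%N) + (w.*2.+2 - (p == 2%N)))%N.
  by clear -le_we; case: eqP; lia.
rewrite expnD PoszM dvdz_mul //.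
  by rewrite dvdzE /= /T dvdn_mulr.
have {}ED : (Posz (p ^ (w.*2.+2 - (p == 2%N))) %| Posz E - Posz D)%Z.
  by rewrite -eqz_mod_dvd !modz_nat ED.
have [p2|p_odd] := eqVneq p 2%N; last first.
  have -> : (-1) ^+ (p * k) = (-1) ^+ k :> int.
    have [p2|odd_p] := even_prime p_pr; first by rewrite p2 in p_odd.
    by rewrite -GRing.signr_odd oddM odd_p GRing.signr_odd.
  rewrite -GRing.mulrBr dvdz_mull //.
  by move: ED; rewrite (negPf p_odd).
have -> : (-1) ^+ (p * k) = 1 :> int.
  by rewrite p2 GRing.exprM GRing.sqrrN !GRing.expr1n.
rewrite -GRing.signr_odd; move: ED; rewrite p2 /=.
(* For p = 2 the signs can differ only if k is odd, which forces w = 0; then only the parity of [E]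
   and [D] counts. *)
case: w {le_we dbase dn'} dk => [|w] dk ED.
  clearbody D E; clear -ED; move: ED.
  by rewrite -[(2 ^ _)%N]/2%N; case: (odd k); rewrite ?GRing.expr1 ?GRing.expr0; lia.
have -> : odd k = false.
  by apply/negbTE; rewrite -dvdn2; apply: dvdn_trans dk; rewrite p2 expnS dvdn_mulr.
by rewrite !GRing.mul1r.
Qed.

End Factorials.

Local Open Scope ring_scope.

(** The term k = 0 stands apart because [big_dvdn_nat] starts at 1. *)
Lemma s18E (n : nat) : (0 < n)%N ->
  s18 n = s18_term n 0 + \sum_(1 <= k < (n %/ 3).+1) s18_term n k.
Proof.
rewrite /s18; case: eqP => [->|_] // _.
rewrite [LHS]big_ltn //.
have E k : (-1) ^+ k * Posz 'C(n, k) * Posz 'C(2 * k, k)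
    * Posz 'C(2 * (n - k), n - k)
    * (Posz 'C(2 * n - 3 * k - 1, n) + Posz 'C(2 * n - 3 * k, n)) = s18_term n k.
  by rewrite /s18_term /s18_base /s18_tail !PoszM PoszD !GRing.mulrA.
by rewrite E; congr (_ + _); apply: eq_bigr => k _; rewrite E.
Qed.

Lemma s18Mp_modz (p n e : nat) : prime p -> (0 < n)%N -> (p ^ e %| n)%N ->
  (Posz (p ^ (2 * e.+1)) %| s18 (p * n) - s18 n)%Z.
Proof.
move=> p_pr n_gt0 dn; have p_gt0 := prime_gt0 p_pr.
have pn_gt0 : (0 < p * n)%N by rewrite muln_gt0 p_gt0.
rewrite !s18E // (bigID (fun k => p %| k)%N) /= big_dvdn_nat //.
(* So the multiples of p in the range for pn are exactly p times the range for n. *)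
rewrite (_ : (p * n) %/ 3 %/ p = n %/ 3)%N; last first.
  by rewrite -divnMA [(3 * p)%N]mulnC divnMA mulKn.
set S' := \sum_(_ <= k < _ | ~~ _) _; set S := \sum_(_ <= j < _) _.
set S0 := \sum_(_ <= k < _) _.
have -> : s18_term (p * n) 0 + (S + S') - (s18_term n 0 + S0)
    = s18_term (p * n) 0 - s18_term n 0 + (S - S0) + S' by ring.
rewrite -GRing.sumrB.
apply: GRing.rpredD; first apply: GRing.rpredD.
- by have := s18_termMp_modz p_pr n_gt0 (leq0n n : 3 * 0 <= n)%N dn; rewrite muln0.
- rewrite big_nat_cond; apply: GRing.rpred_sum => j /andP[lt_j _].
  by apply: s18_termMp_modz => //; lia.
(* Indices prime to p: each term vanishes because p^(e+1) divides pn. *)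
- rewrite /S' big_nat_cond; apply: GRing.rpred_sum => k /andP[lt_k pk].
  apply: dvdz_mull; rewrite dvdzE /= dvdn_mulr // s18_base_dvd_ndvd //.
    by lia.
  by rewrite expnS dvdn_mul.
Qed.

Theorem theorem1p3 (m r p : nat) (hm : (1 <= m)%N) (hr : (1 <= r)%N)
    (hp : prime p) :
  (s18 (m * p ^ r)%N = s18 (m * p ^ (r - 1))%N %[mod (p ^ (2 * r))%N%:Z])%Z.
Proof.
case: r hr => // r _; rewrite subn1 /=.
apply/eqP; rewrite eqz_mod_dvd expnS mulnCA.
by apply: s18Mp_modz; rewrite // ?dvdn_mull // muln_gt0 hm expn_gt0 prime_gt0.
Qed.
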